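(* For every $r\ge1$, polyhedral $k$-chains are dense in the Banach space $\hat{\mathcal B}_k^r$ of differential $k$-chains of class $B^r$ in $\mathbb R^n$.
   Context: Fix the standard inner product on $\mathbb R^n$, extended to $k$-vectors by $\langle u_1\wedge\dots\wedge u_k,v_1\wedge\dots\wedge v_k\rangle=\det(\langle u_i,v_j\rangle)$. A simple $k$-vector has mass $\|\alpha\|=\sqrt{\langle\alpha,\alpha\rangle}$; a general one has mass $\|\alpha\|=\inf\{\sum\|\alpha_j\|:\alpha=\sum\alpha_j,\ \alpha_j \text{ simple}\}$. $\mathcal A_k$ is the space of Dirac $k$-chains: finite formal sums $\sum(p_i;\alpha_i)$, $p_i\in\mathbb R^n$, $\alpha_i\in\Lambda_k(\mathbb R^n)$ (finitely supported functions $\mathbb R^n\to\Lambda_k(\mathbb R^n)$). With $T_u(p;\alpha)=(p+u;\alpha)$ and $\sigma=u_1\circ\dots\circ u_j$ a symmetric product of vectors, put $\|\sigma\|=\|u_1\|\cdots\|u_j\|$ and $\Delta_{\sigma}(p;\alpha)=(T_{u_1}-I)\cdots(T_{u_j}-I)(p;\alpha)$ (for $j=0$: $(p;\alpha)$, $\|\sigma\|=1$); this has order $j$. $\|A\|_{B^r}=\inf\{\sum_i\|\sigma_i\|\|\alpha_i\|: A=\sum_i\Delta_{\sigma_i}(p_i;\alpha_i)$ (finite sum), orders $\le r\}$ is a norm on $\mathcal A_k$ and $\hat{\mathcal B}_k^r$ is the completion. The norms decrease in $r$, so the identity induces continuous maps $\hat{\mathcal B}_k^1\to\hat{\mathcal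 B}_k^r$, $r\ge1$. A $k$-form is a linear functional $\omega$ on $\mathcal A_k$; $\mathcal B_k^1$ is the space of forms with $\max_{j=0,1}\sup\{|\omega(\Delta_\sigma(p;\alpha))|:\sigma\text{ of order }j,\ \|\sigma\|\|\alpha\|=1\}<\infty$ (bounded Lipschitz forms). For $J\in\hat{\mathcal B}_k^1$, $\omega\in\mathcal B_k^1$: $\int_J\omega=\lim\omega(A_i)$ for Dirac chains $A_i\to J$ in the $B^1$ norm. An affine $n$-cell in $\mathbb R^n$ is an intersection of finitely many affine half spaces whose closure is compact; an affine $k$-cell in $\mathbb R^n$ is an affine $k$-cell in a $k$-dimensional affine subspace of $\mathbb R^n$ (open or closed). For an oriented affine $k$-cell $Q$, $\widetilde Q\in\hat{\mathcal B}_k^1$ is the unique chain with $\int_{\widetilde Q}\omega=\int_Q\omega$ (Riemann integral) for all $\omega\in\mathcal B_k^1$. A polyhedral $k$-chain is a finite sum $\sum a_i\widetilde{Q_i}$ with $a_i\in\mathbb R$ and $Q_i$ oriented affine $k$-cells in $\mathbb R^n$, viewed in $\hat{\mathcal B}_k^r$ via $\hat{\mathcal B}_k^1\to\hat{\mathcal B}_k^r$. *)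

(* Defs.v *)
From HB Require Import structures.
From mathcomp Require Import all_boot all_order all_algebra finmap.
From mathcomp Require Import all_classical all_reals all_analysis.
From mathcomp Require Import fingroup perm generic_quotient ring_quotient.
From mathcomp Require Import lra.

Set Implicit Arguments.
Unset Strict Implicit.
Unset Printing Implicit Defensive.

Import Order.TTheory GRing.Theory Num.Theory numFieldNormedType.Exports.

Local Open Scope classical_set_scope.
Local Open Scope ring_scope.
Local Open Scope quotient_scope.

Record seminorm (R : realType) (V : lmodType R) := Seminorm {
  sn :> V -> R;
  snD : forall x y, sn (x + y) <= sn x + sn y;
  snZ : forall a x, sn (a *: x) = `|a| * sn x }.

Section SeminormTheory.
Context {R : realType} {V : lmodType R} (N : seminorm V).

Lemma sn0 : N 0 = 0.
Proof. by rewrite -(scale0r (0 : V)) snZ normr0 mul0r. Qed.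

Lemma snN x : N (- x) = N x.
Proof. by rewrite -scaleN1r snZ normrN normr1 mul1r. Qed.

Lemma sn_ge0 x : 0 <= N x.
Proof. have := snD N x (- x); rewrite subrr sn0 snN; lra. Qed.

Lemma snB x y : N (x - y) <= N x + N y.
Proof. by rewrite -(snN y) snD. Qed.

Lemma sn_distC x y : N (x - y) = N (y - x).
Proof. by rewrite -snN opprB. Qed.

Lemma sn_dist x y : `|N x - N y| <= N (x - y).
Proof.
have := snD N (x - y) y; have := snD N (y - x) x.
by rewrite !subrK (sn_distC y x) ler_norml => ? ?; apply/andP; split; lra.
Qed.

Lemma sn_tri x y z : N (x - z) <= N (x - y) + N (y - z).
Proof. by have := snD N (x - y) (y - z); rewrite addrA subrK. Qed.

End SeminormTheory.

Section CauchySequences.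
Context {R : realType} {V : lmodType R} (N : seminorm V).

Definition sn_cauchy (u : nat -> V) := forall e : R, 0 < e ->
  exists M, forall i j, (M <= i)%N -> (M <= j)%N -> N (u i - u j) < e.

Definition sn_null (u : nat -> V) := forall e : R, 0 < e ->
  exists M, forall i, (M <= i)%N -> N (u i) < e.

Definition cauchy_pred : {pred nat -> V} := fun u => `[<sn_cauchy u>].

Lemma cauchy_pred_submod : submod_closed cauchy_pred.
Proof.
split.
  apply/asboolP => e e0; exists 0%N => i j _ _.
  by rewrite subr0 sn0.
move=> a u v /asboolP uc /asboolP vc; apply/asboolP => e e0.
have a0 : 0 < `|a| + 1 by rewrite ltr_wpDl.
have [M1 h1] := uc (e / 2 / (`|a| + 1)) ltac:(by rewrite !divr_gt0).
have [M2 h2] := vc (e / 2) ltac:(by rewrite divr_gt0).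
exists (maxn M1 M2) => i j; rewrite !geq_max => /andP[i1 i2] /andP[j1 j2].
have -> : (a *: u + v) i - (a *: u + v) j = a *: (u i - u j) + (v i - v j).
  by rewrite !fctE scalerBr opprD addrACA.
apply: (le_lt_trans (snD _ _ _)); rewrite snZ.
have {}h1 := h1 _ _ i1 j1; have {}h2 := h2 _ _ i2 j2.
have : `|a| * N (u i - u j) <= e / 2.
  rewrite ltr_pdivlMr// in h1; apply: le_trans (ltW h1).
  by rewrite mulrC ler_wpM2l ?sn_ge0// lerDl.
lra.
Qed.
HB.instance Definition _ := GRing.isSubmodClosed.Build R (nat -> V)
  cauchy_pred cauchy_pred_submod.

Record cauchy_seqs := CauchySeqs {
  cseq :> nat -> V; _ : cseq \in cauchy_pred }.
HB.instance Definition _ := [isSub for cseq].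
HB.instance Definition _ := [Choice of cauchy_seqs by <:].
HB.instance Definition _ := [SubChoice_isSubLmodule of cauchy_seqs by <:].

Definition null_pred : {pred cauchy_seqs} := fun u => `[<sn_null u>].

Lemma null_pred_submod : submod_closed null_pred.
Proof.
split; first by apply/asboolP => e e0; exists 0%N => i _; rewrite sn0.
move=> a u v /asboolP uc /asboolP vc; apply/asboolP => e e0.
have a0 : 0 < `|a| + 1 by rewrite ltr_wpDl.
have [M1 h1] := uc (e / 2 / (`|a| + 1)) ltac:(by rewrite !divr_gt0).
have [M2 h2] := vc (e / 2) ltac:(by rewrite divr_gt0).
exists (maxn M1 M2) => i; rewrite !geq_max => /andP[i1 i2].
apply: (le_lt_trans (snD _ _ _)); rewrite snZ.
have {}h1 := h1 _ i1; have {}h2 := h2 _ i2.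
have : `|a| * N (u i) <= e / 2.
  rewrite ltr_pdivlMr// in h1; apply: le_trans (ltW h1).
  by rewrite mulrC ler_wpM2l ?sn_ge0// lerDl.
lra.
Qed.
HB.instance Definition _ := GRing.isSubmodClosed.Build R cauchy_seqs
  null_pred null_pred_submod.

(* Cauchy sequences for N modulo N-null sequences. *)
Definition completion := Quotient.quot null_pred.
HB.instance Definition _ := GRing.Zmodule.on completion.


Lemma cseqP (u : cauchy_seqs) : sn_cauchy u.
Proof. by case: u => u /= /asboolP. Qed.

Definition cclass (u : cauchy_seqs) : completion := \pi u.

Lemma cclassK (x : completion) : cclass (repr x) = x.
Proof. exact: reprK. Qed.

Lemma cclass_eq (u v : cauchy_seqs) :
  cclass u = cclass v <-> sn_null (fun i => u i - v i).
Proof.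
split=> [/eqP|h].
  by rewrite -Quotient.idealrBE => /asboolP.
by apply/eqP; rewrite -Quotient.idealrBE; apply/asboolP.
Qed.

Lemma cclassD u v : cclass (u + v) = cclass u + cclass v.
Proof. exact: (raddfD (\pi_completion)). Qed.

Definition cscale (a : R) (x : completion) : completion :=
  cclass (a *: repr x).

Lemma cclassZ a u : cclass (a *: u) = cscale a (cclass u).
Proof.
apply/eqP; rewrite -Quotient.idealrBE -scalerBr rpredZ//.
by rewrite Quotient.idealrBE reprK.
Qed.

Fact cscaleA a b x : cscale a (cscale b x) = cscale (a * b) x.
Proof. by rewrite -[x]cclassK -!cclassZ scalerA. Qed.
Fact cscale1 : left_id 1 cscale.
Proof. by move=> x; rewrite -[x]cclassK -cclassZ scale1r. Qed.
Fact cscaleDr : right_distributive cscale +%R.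
Proof.
move=> a x y; rewrite -[x]cclassK -[y]cclassK -cclassD -!cclassZ -cclassD.
by rewrite scalerDr.
Qed.
Fact cscaleDl x : {morph cscale^~ x : a b / a + b}.
Proof. by move=> a b; rewrite -[x]cclassK -!cclassZ -cclassD scalerDl. Qed.

HB.instance Definition _ := GRing.Zmodule_isLmodule.Build R completion
  cscaleA cscale1 cscaleDr cscaleDl.

Definition cnorm (x : completion) : R := lim (N (repr x i) @[i --> \oo]).

Lemma cseq_is_cvg (u : cauchy_seqs) : cvg (N (u i) @[i --> \oo]).
Proof.
apply/cauchy_cvgP/cauchy_exP => e e0.
have [M h] := cseqP u e0; exists (N (u M)).
exists M => // i /= Mi; rewrite /ball /=.
exact: le_lt_trans (sn_dist _ _ _) (h _ _ (leqnn _) Mi).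
Qed.

Lemma cnormP (u : cauchy_seqs) : N (u i) @[i --> \oo] --> cnorm (cclass u).
Proof.
set v := repr (cclass u).
have /cclass_eq uv : cclass u = cclass v by rewrite cclassK.
have -> : cnorm (cclass u) = lim (N (v i) @[i --> \oo]) by [].
apply: (@cvg_sub0 _ _ _ _ _ _ (fun i => N (v i))); last exact: cseq_is_cvg.
apply/cvgrPdist_lt => e /uv[M h]; exists M => // i /= Mi.
rewrite sub0r normrN; exact: le_lt_trans (sn_dist _ _ _) (h _ Mi).
Qed.

Arguments cnormP : clear implicits.

Fact cnormD x y : cnorm (x + y) <= cnorm x + cnorm y.
Proof.
rewrite -[x]cclassK -[y]cclassK -cclassD.
set u := repr x; set v := repr y.
have h : (N (u i) + N (v i)) @[i --> \oo] -->
    cnorm (cclass u) + cnorm (cclass v) by apply: cvgD; exact: cnormP.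
apply: (ler_cvg_to (cnormP (u + v)) h).
by near=> i; exact: snD.
Unshelve. all: by end_near. Qed.

Fact cnormZ a x : cnorm (a *: x) = `|a| * cnorm x.
Proof.
rewrite -[x]cclassK -[X in cnorm X]cclassZ.
set u := repr x.
apply: (@cvg_unique _ _ (N ((a *: u : cauchy_seqs) i) @[i --> \oo])).
- exact: norm_hausdorff.
- exact: cnormP.
have -> : (fun i => N ((a *: u : cauchy_seqs) i)) = (fun i => `|a| * N (u i)).
  by apply/funext => i; rewrite /= snZ.
by apply: cvgMl_tmp; exact: cnormP.
Qed.

Fact cnorm_eq0 x : cnorm x = 0 -> x = 0.
Proof.
rewrite -[x]cclassK; set u := repr x => u0.
have -> : 0 = cclass 0 by rewrite /cclass raddf0.
apply/cclass_eq => e e0.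
have := cnormP u; rewrite u0 => /cvgrPdist_lt/(_ e e0)[M _ h].
exists M => i Mi; have := h i Mi.
by rewrite /= sub0r normrN ger0_norm ?sn_ge0// subr0.
Qed.

HB.instance Definition _ := Lmodule_isNormed.Build R completion
  cnormD cnormZ cnorm_eq0.

Fact cst_cauchy v : (fun=> v) \in cauchy_pred.
Proof. by apply/asboolP => e e0; exists 0%N => *; rewrite subrr sn0. Qed.

Definition embed (v : V) : completion := cclass (CauchySeqs (cst_cauchy v)).

Fact embed_linear : linear embed.
Proof.
move=> a v w.
have -> : a *: embed v + embed w =
  cclass (a *: CauchySeqs (cst_cauchy v) + CauchySeqs (cst_cauchy w)).
  by rewrite cclassD cclassZ.
by congr cclass; exact/val_inj.
Qed.
HB.instance Definition _ := GRing.isLinear.Build R V completion *:%R embed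
  embed_linear.

Lemma norm_embed v : `|embed v| = N v.
Proof.
apply: (@cvg_unique _ _ (N v @[i --> \oo])).
- exact: norm_hausdorff.
- exact: cnormP (CauchySeqs (cst_cauchy v)).
- exact: cvg_cst.
Qed.

Lemma embed_cvg (u : cauchy_seqs) : embed (u i) @[i --> \oo] --> cclass u.
Proof.
apply/cvgrPdist_le => e e0; have [M h] := cseqP u e0.
exists M => // i /= Mi.
have -> : cclass u - embed (u i) = cclass (u - CauchySeqs (cst_cauchy (u i))).
  by rewrite cclassD /cclass (raddfN (\pi_completion)).
apply: (ler_cvg_to (cnormP _) (cvg_cst e)).
by exists M => // j Mj; apply/ltW/h.
Qed.

Arguments embed_cvg : clear implicits.

(* A Cauchy sequence of V converging to x. *)
Definition crep (x : completion) : nat -> V := repr x.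

Lemma crep_cvg x : embed (crep x i) @[i --> \oo] --> x.
Proof. by have := embed_cvg (repr x); rewrite cclassK. Qed.

Arguments crep_cvg : clear implicits.

Lemma embed_dense : dense (range embed).
Proof.
move=> O [x Ox] oO; rewrite -[x]cclassK in Ox.
have [|M _ h] := embed_cvg (repr x) O; first exact: open_nbhs_nbhs.
by exists (embed (repr x M)); split; [exact: h M (leqnn M)|exists (repr x M)].
Qed.

Fact completion_complete (F : set_system completion) :
  ProperFilter F -> cauchy F -> cvg F.
Proof.
move=> FF /cauchyP cF.
have d0 m : 0 < m.+1%:R^-1 / 2 :> R by rewrite divr_gt0 ?invr_gt0.
have [x hx] := choice (fun m => cF _ (d0 m)).
have /choice[v hv] m : exists v : V, `|x m - embed v| < m.+1%:R^-1 / 2.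
  have := @embed_dense (ball (x m) (m.+1%:R^-1 / 2)).
  case; [by exists (x m); exact: ballxx|exact: ball_open|].
  by move=> y [+ [w _ wy]]; rewrite -wy -ball_normE; exists w.
have Fv m : F (ball (embed (v m)) m.+1%:R^-1).
  apply: filterS (hx m) => y; rewrite -!ball_normE /= => h.
  rewrite [m.+1%:R^-1]splitr.
  by rewrite (le_lt_trans (ler_distD (x m) _ _))// ltrD// distrC.
have vc : v \in cauchy_pred.
  apply/asboolP => e e0.
  have [M _ hM] := near_infty_natSinv_lt (PosNum (divr_gt0 e0 (ltr0n _ 2))).
  exists M => i j Mi Mj.
  have [y []] := filter_ex (filterI (Fv i) (Fv j)); rewrite -!ball_normE /=.
  have {}hM m : (M <= m)%N -> m.+1%:R^-1 < e / 2 by move=> /hM.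
  move=> /lt_trans/(_ (hM _ Mi)) hi /lt_trans/(_ (hM _ Mj)) hj.
  rewrite -norm_embed raddfB [e]splitr.
  by rewrite (le_lt_trans (ler_distD y _ _))// ltrD// distrC.
apply/cvg_ex; exists (cclass (CauchySeqs vc)).
apply/cvgrPdist_lt => e e0.
have [M _ hM] := near_infty_natSinv_lt (PosNum (divr_gt0 e0 (ltr0n _ 2))).
have /cvgrPdist_lt/(_ _ (divr_gt0 e0 (ltr0n _ 2)))[M' _ hM'] :=
  embed_cvg (CauchySeqs vc).
pose m := maxn M M'.
apply: filterS (Fv m) => y; rewrite -ball_normE /= => h.
rewrite [e]splitr (le_lt_trans (ler_distD (embed (v m)) _ _))// ltrD//.
  exact: (hM' m (leq_maxr _ _)).
exact: lt_trans h (hM m (leq_maxl _ _)).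
Qed.
HB.instance Definition _ := Uniform_isComplete.Build completion
  completion_complete.

Lemma crep_bounded_cvg (W : completeNormedModType R) (g : V -> W) (C : R)
    (gB : forall v w, g (v - w) = g v - g w)
    (gC : forall v, `|g v| <= C * N v) (A : nat -> V) (x : completion) :
  embed (A i) @[i --> \oo] --> x ->
  g (A i) @[i --> \oo] --> lim (g (crep x i) @[i --> \oo]).
Proof.
have D0 : 0 < `|C| + 1 by rewrite ltr_wpDl.
have {}gC v w (e : R) : N (v - w) < e / (`|C| + 1) -> `|g v - g w| < e.
  rewrite ltr_pdivlMr// -gB => h; apply: le_lt_trans (gC _) _.
  apply: le_lt_trans h; rewrite mulrC ler_wpM2l ?sn_ge0//.
  by apply: le_trans (ler_norm _) _; rewrite lerDl.
move=> Ax; apply: (@cvg_sub0 _ _ _ _ _ _ (fun i => g (crep x i))); last first.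
  apply/cauchy_cvgP/cauchy_exP => e e0.
  have [M h] := cseqP (repr x) (divr_gt0 e0 D0); exists (g (crep x M)).
  by exists M => // i /= Mi; rewrite -ball_normE /=; apply/gC/h.
apply/cvgrPdist_lt => e e0.
have d0 : 0 < e / (`|C| + 1) / 2 by rewrite !divr_gt0.
have /cvgrPdist_lt/(_ _ d0) h1 := Ax.
have /cvgrPdist_lt/(_ _ d0) h2 := crep_cvg x.
near=> i; rewrite sub0r normrN; apply: gC.
rewrite -norm_embed raddfB [X in _ < X]splitr.
apply: le_lt_trans (ler_distD x _ _) _; rewrite ltrD//; last by near: i.
by rewrite distrC; near: i.
Unshelve. all: by end_near. Qed.

End CauchySequences.


(* The infimum of the costs of the finite decompositions of v into sums of
   elements f i with i in P, where f i is charged c i. *)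
Section DecompositionNorm.
Context {R : realType} {V : lmodType R} {I : eqType}.
Variables (P : set I) (f : I -> V) (c : I -> R).

Definition decompositions (v : V) : set R :=
  [set s | exists l : seq I, {in l, forall i, P i} /\
    v = \sum_(i <- l) f i /\ s = \sum_(i <- l) c i].

Definition decomposition_norm (v : V) : R := inf (decompositions v).

Hypothesis c_ge0 : forall i, 0 <= c i.
Hypothesis scal : forall a i, P i ->
  exists2 j, P j & f j = a *: f i /\ c j = `|a| * c i.
Hypothesis span : forall v, decompositions v !=set0.

Fact decomposition_lb v : has_lbound (decompositions v).
Proof. by exists 0 => _ [l [_ [_ ->]]]; exact: sumr_ge0. Qed.

Fact decomposition_normD v w :
  decomposition_norm (v + w) <= decomposition_norm v + decomposition_norm w.
Proof.
rewrite -lerBlDr; apply: lb_le_inf => // _ [l [lP [-> ->]]].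
rewrite lerBlDr -lerBlDl; apply: lb_le_inf => // _ [l' [lP' [-> ->]]].
rewrite lerBlDl; apply: ge_inf; first exact: decomposition_lb.
exists (l ++ l'); rewrite !big_cat; split=> // i.
by rewrite mem_cat => /orP[/lP|/lP'].
Qed.

Fact decomposition_norm_le a v :
  decomposition_norm (a *: v) <= `|a| * decomposition_norm v.
Proof.
have H s : decompositions v s -> decompositions (a *: v) (`|a| * s).
  move=> [l [lP [-> ->]]]; elim: l lP => [|i l IH] lP.
    by exists [::]; rewrite !big_nil scaler0 mulr0.
  have [|l' [lP' [e1 e2]]] := IH.
    by move=> j jl; apply: lP; rewrite inE jl orbT.
  have [|j Pj [e3 e4]] := @scal a i; first by apply: lP; exact: mem_head.
  exists (j :: l'); rewrite !big_cons scalerDr mulrDr e1 e2 e3 e4; split=> //.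
  by move=> x; rewrite inE => /orP[/eqP ->|/lP'].
have [->|a0] := eqVneq a 0.
  rewrite scale0r normr0 mul0r; apply: ge_inf; first exact: decomposition_lb.
  by exists [::]; rewrite !big_nil.
rewrite mulrC -ler_pdivrMr ?normr_gt0//; apply: lb_le_inf => // s /H sv.
rewrite ler_pdivrMr ?normr_gt0// mulrC.
by apply: ge_inf => //; exact: decomposition_lb.
Qed.

Fact decomposition_normZ a v :
  decomposition_norm (a *: v) = `|a| * decomposition_norm v.
Proof.
apply/eqP; rewrite eq_le decomposition_norm_le /=.
have [->|a0] := eqVneq a 0.
  rewrite normr0 mul0r; apply: lb_le_inf => // _ [l [_ [_ ->]]].
  exact: sumr_ge0.
rewrite mulrC -ler_pdivlMr ?normr_gt0//.
have := decomposition_norm_le a^-1 (a *: v).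
by rewrite scalerA mulVf// scale1r normfV mulrC.
Qed.

End DecompositionNorm.

(* A k-vector of R^n is given by its coordinates in the basis of the
   e_(I 0) /\ ... /\ e_(I (k-1)) for I strictly increasing; wedge u is the
   exterior product of the rows of u, with the k-minors of u as coordinates. *)
Definition increasing n k (f : {ffun 'I_k -> 'I_n}) :=
  [forall i : 'I_k, forall j : 'I_k, (i < j)%N ==> (f i < f j)%N].

Definition multi_index n k := {f : {ffun 'I_k -> 'I_n} | increasing f}.

Definition kvector (R : realType) (n k : nat) := {ffun multi_index n k -> R^o}.

Section KVectors.
Context {R : realType} {n k : nat}.
Implicit Types (u v : 'M[R]_(k, n)) (alpha beta : kvector R n k).

Definition wedge u : kvector R n k :=
  [ffun I : multi_index n k => \det (colsub (val I) u)].

(* See kdot_wedge_gram for the value on exterior products. *)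
Definition kdot alpha beta : R := \sum_I alpha I * beta I.

Definition simple_mass alpha : R := Num.sqrt (kdot alpha alpha).

(* The scalar factor only matters for k = 0, where wedge u is always 1. *)
Definition simple_kvector : set (kvector R n k) :=
  [set alpha | exists (a : R) u, alpha = a *: wedge u].

(* By mass_simple, this is simple_mass on simple k-vectors. *)
Definition mass : kvector R n k -> R :=
  decomposition_norm simple_kvector id simple_mass.

Lemma increasingP (f : {ffun 'I_k -> 'I_n}) :
  reflect (forall i j : 'I_k, (i < j)%N -> (f i < f j)%N) (increasing f).
Proof.
apply: (iffP forallP) => [h i j ij|h i].
  by have /forallP/(_ j)/implyP/(_ ij) := h i.
by apply/forallP => j; apply/implyP; exact: h.
Qed.

Lemma enum_ord_sorted m : sorted (fun i j : 'I_m => (i < j)%N) (enum 'I_m).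
Proof. by have := iota_ltn_sorted 0 m; rewrite -val_enum_ord sorted_map. Qed.

Lemma multi_index_eq (I J : multi_index n k) :
  (forall i, exists j, val I i = val J j) -> I = J.
Proof.
move=> h; apply/val_inj/ffunP => i.
have sI (K : multi_index n k) :
    sorted (fun i j : 'I_n => (i < j)%N) (codom (val K)).
  apply: (homo_sorted (e := fun i j : 'I_k => (i < j)%N)).
    exact/increasingP/(valP K).
  exact: enum_ord_sorted.
have tr : transitive (fun i j : 'I_n => (i < j)%N).
  by move=> a b c; exact: ltn_trans.
have ir : irreflexive (fun i j : 'I_n => (i < j)%N).
  by move=> a; exact: ltnn.
have uI (K : multi_index n k) : uniq (codom (val K)).
  exact: sorted_uniq tr ir _ (sI K).
have sub : {subset codom (val I) <= codom (val J)}.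
  move=> x /codomP[a ->]; have [b ->] := h a; exact: codom_f.
have [|_ eqIJ] := uniq_min_size (uI I) sub; first by rewrite !size_codom.
have : codom (val I) = codom (val J).
  exact: irr_sorted_eq tr ir _ _ (sI I) (sI J) eqIJ.
by move=> /eq_in_map; apply; rewrite mem_enum.
Qed.

Lemma multi_index_inj (I : multi_index n k) : injective (val I).
Proof.
move=> i j e; apply/val_inj/eqP; rewrite /= eqn_leq leqNgt [X in _ && X]leqNgt.
have /increasingP h := valP I.
by apply/andP; split; apply/negP => /h; rewrite e ltnn.
Qed.

Lemma wedge_sort (f : {ffun 'I_k -> 'I_n}) : injective f ->
  exists (I : multi_index n k) (s : 'S_k), forall i, f i = val I (s i).
Proof.
move=> finj; pose l := enum (codom f).
have sl : size l = k by rewrite -cardE card_codom// card_ord.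
have fl i : f i \in l by rewrite mem_enum codom_f.
have ltl : sorted (fun i j : 'I_n => (i < j)%N) l.
  have := enum_ord_sorted n; rewrite enumT /l /enum_mem.
  by apply: sorted_filter => a b c; exact: ltn_trans.
pose I0 := [ffun i : 'I_k => nth (f i) l i].
have Iincr : increasing I0.
  apply/increasingP => i j ij; rewrite !ffunE.
  rewrite (set_nth_default (f j)) ?sl//.
  have tr : transitive (fun i j : 'I_n => (i < j)%N).
    by move=> a b c; exact: ltn_trans.
  by have := sorted_ltn_nth tr (f j) ltl; apply; rewrite ?inE ?sl.
have si i : (index (f i) l < k)%N by rewrite -[X in (_ < X)%N]sl index_mem.
have sinj : injective (fun i => Ordinal (si i)).
  move=> i j /(congr1 val) /= e; apply: finj.
  by rewrite -(nth_index (f i) (fl i)) e nth_index.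
exists (exist _ I0 Iincr), (perm sinj) => i /=.
rewrite permE ffunE /= (set_nth_default (f i)) ?nth_index//.
by rewrite index_mem.
Qed.

(* Cauchy-Binet formula. *)
Lemma kdot_wedge u v : kdot (wedge u) (wedge v) = \det (u *m v^T).
Proof.
have e1 : \det (u *m v^T) = \sum_(f : {ffun 'I_k -> 'I_n})
    (\prod_i u i (f i)) * \det (colsub f v).
  transitivity (\sum_(f : {ffun 'I_k -> 'I_n}) \sum_(s : 'S_k)
    (-1) ^+ s * \prod_i (u i (f i) * v (s i) (f i))).
    rewrite exchange_big; apply: eq_bigr => s _; rewrite -big_distrr/=.
    congr (_ * _); rewrite -(bigA_distr_bigA (fun i j => u i j * v (s i) j)).
    by apply: eq_bigr => i _; rewrite mxE; apply: eq_bigr => j _; rewrite mxE.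
  apply: eq_bigr => f _; rewrite -det_tr big_distrr /=; apply: eq_bigr => s _.
  rewrite mulrCA; congr (_ * _); rewrite big_split; congr (_ * _).
  by apply: eq_bigr => i _; rewrite !mxE.
rewrite e1 (bigID (fun f : {ffun 'I_k -> 'I_n} => injectiveb f)) /=.
rewrite [X in _ + X]big1 ?addr0; last first.
  move=> f /injectivePn[i [j ij fij]].
  rewrite -det_tr (determinant_alternate ij) ?mulr0// => a.
  by rewrite !mxE fij.
pose h (x : multi_index n k * 'S_k) : {ffun 'I_k -> 'I_n} :=
  [ffun i => val x.1 (x.2 i)].
have hinj : injective h.
  move=> [I s] [J t] /ffunP e; have E i : val I (s i) = val J (t i).
    by have := e i; rewrite !ffunE.
  have IJ : I = J.
    apply: multi_index_eq => i; exists (t ((s^-1)%g i)).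
    by rewrite -E permKV.
  rewrite -IJ in E *; congr pair; apply/permP => i.
  by have /multi_index_inj := E i.
pose D : {set multi_index n k * 'S_k} := finset.setTfor _.
transitivity (\sum_(f in h @: D)
   (\prod_i u i (f i)) * \det (colsub f v)); last first.
  apply: eq_bigl => f; apply/imsetP/injectiveP => [[[I s] _ ->] i j|finj].
    by rewrite !ffunE => /multi_index_inj/perm_inj.
  have [I [s fE]] := wedge_sort finj; exists (I, s).
    exact: finset.in_setT.
  by apply/ffunP => i; rewrite ffunE.
rewrite big_imset /=; last by move=> x y _ _; exact: hinj.
rewrite (eq_bigl xpredT); last by move=> x; rewrite finset.in_setT.
rewrite -(pair_bigA _ (fun I (s : 'S_k) =>
  (\prod_i u i (h (I, s) i)) * \det (colsub (h (I, s)) v))) /=.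
apply: eq_bigr => I _; rewrite !ffunE [X in X * _]/(\det _) big_distrl /=.
apply: eq_bigr => s _.
have -> : colsub (h (I, s)) v = col_perm s (colsub (val I) v).
  by apply/matrixP => i j; rewrite !mxE ffunE.
rewrite col_permE det_mulmx det_perm odd_permV.
rewrite [LHS]mulrC [RHS]mulrCA; congr (_ * _).
rewrite [LHS]mulrC; congr (_ * _).
by apply: eq_bigr => i _; rewrite ffunE mxE.
Qed.


Lemma kdotC alpha beta : kdot alpha beta = kdot beta alpha.
Proof. by apply: eq_bigr => I _; rewrite mulrC. Qed.

Lemma kdotDl alpha alpha' beta :
  kdot (alpha + alpha') beta = kdot alpha beta + kdot alpha' beta.
Proof. by rewrite -big_split; apply: eq_bigr => I _; rewrite ffunE mulrDl. Qed.

Lemma kdotZl a alpha beta : kdot (a *: alpha) beta = a * kdot alpha beta.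
Proof.
rewrite /kdot big_distrr; apply: eq_bigr => I _.
by rewrite ffunE; exact/esym/mulrA.
Qed.

Lemma kdot_ge0 alpha : 0 <= kdot alpha alpha.
Proof. by apply: sumr_ge0 => I _; rewrite -expr2 sqr_ge0. Qed.

Lemma kdot_eq0 alpha : kdot alpha alpha = 0 -> alpha = 0.
Proof.
move=> /eqP; rewrite psumr_eq0; last by move=> I _; rewrite -expr2 sqr_ge0.
move=> /allP h; apply/ffunP => I; rewrite ffunE; apply/eqP.
by have := h I (mem_index_enum I); rewrite /= mulf_eq0 orbb.
Qed.

Lemma simple_mass_ge0 alpha : 0 <= simple_mass alpha.
Proof. exact: sqrtr_ge0. Qed.

Lemma simple_massZ a alpha :
  simple_mass (a *: alpha) = `|a| * simple_mass alpha.
Proof.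
rewrite /simple_mass kdotZl kdotC kdotZl mulrA -expr2 sqrtrM ?sqr_ge0//.
by rewrite sqrtr_sqr.
Qed.

Lemma simple_massD alpha beta :
  simple_mass (alpha + beta) <= simple_mass alpha + simple_mass beta.
Proof.
have sA := sqr_sqrtr (kdot_ge0 alpha); have sB := sqr_sqrtr (kdot_ge0 beta).
have cs : kdot alpha beta <= simple_mass alpha * simple_mass beta.
  have [b0|b0] := eqVneq (kdot beta beta) 0.
    rewrite (kdot_eq0 b0) -[0](scale0r (0 : kvector R n k)) kdotC kdotZl mul0r.
    by rewrite mulr_ge0 ?simple_mass_ge0.
  have bp : 0 < kdot beta beta by rewrite lt_def b0 kdot_ge0.
  have := kdot_ge0 (kdot beta beta *: alpha + (- kdot alpha beta) *: beta).
  rewrite kdotDl !kdotZl (kdotC alpha) (kdotC beta (_ + _)) !kdotDl !kdotZl.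
  rewrite (kdotC beta alpha).
  set A := kdot alpha alpha; set B := kdot beta beta; set C := kdot alpha beta.
  move=> h; have h2 : C ^+ 2 <= A * B.
    rewrite -subr_ge0 -(pmulr_rge0 _ bp); move: h; rewrite -/B; lra.
  apply: (le_trans (ler_norm _)); rewrite -sqrtr_sqr -sqrtrM ?kdot_ge0//.
  by rewrite ler_sqrt// mulr_ge0 ?kdot_ge0.
rewrite {1}/simple_mass -(ger0_norm (addr_ge0 (simple_mass_ge0 alpha)
  (simple_mass_ge0 beta))) -sqrtr_sqr ler_sqrt ?sqr_ge0// sqrrD.
rewrite {1}/simple_mass {3}/simple_mass sA sB.
rewrite kdotDl !(kdotC _ (alpha + beta)) !kdotDl (kdotC beta alpha); lra.
Qed.

Definition basis_frame (I : multi_index n k) : 'M[R]_(k, n) :=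
  \matrix_(i, j) (val I i == j)%:R.

Lemma wedge_basis I J : wedge (basis_frame I) J = (I == J)%:R.
Proof.
rewrite ffunE; have [<-|IJ] := eqVneq I J.
  rewrite -[RHS](det1 R k); congr (\det _); apply/matrixP => i j.
  by rewrite !mxE (inj_eq (@multi_index_inj I)).
have [i hi] : exists i, forall j, val I i != val J j.
  apply: contrapT => /forallNP h; move/eqP: IJ; apply; apply: multi_index_eq.
  move=> i; apply: contrapT => /forallNP h'; apply: (h i) => j.
  exact/eqP/h'.
rewrite (expand_det_row _ i) big1// => j _.
by rewrite !mxE (negbTE (hi j)) mul0r.
Qed.

Lemma kvector_basis alpha : alpha = \sum_I alpha I *: wedge (basis_frame I).
Proof.
apply/ffunP => J; rewrite sum_ffunE (bigD1 J)//= big1 ?addr0.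
  by rewrite ffunE wedge_basis eqxx [RHS]mulr1.
by move=> I IJ; rewrite ffunE wedge_basis (negbTE IJ) [LHS]mulr0.
Qed.

Lemma simple_kvectorZ a alpha :
  simple_kvector alpha -> simple_kvector (a *: alpha).
Proof. by move=> [b [u ->]]; exists (a * b), u; rewrite scalerA. Qed.

Fact mass_scal a alpha : simple_kvector alpha ->
  exists2 beta, simple_kvector beta &
    beta = a *: alpha /\ simple_mass beta = `|a| * simple_mass alpha.
Proof.
move=> sa; exists (a *: alpha); first exact: simple_kvectorZ.
by rewrite simple_massZ.
Qed.

Fact mass_span alpha :
  decompositions simple_kvector id simple_mass alpha !=set0.
Proof.
pose l := map (fun I => alpha I *: wedge (basis_frame I))
  (index_enum (multi_index n k)).
exists (\sum_(beta <- l) simple_mass beta), l; split; last split=> //.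
  by move=> _ /mapP[I _ ->]; exists (alpha I), (basis_frame I).
by rewrite /l big_map -kvector_basis.
Qed.

Definition mass_seminorm : seminorm (kvector R n k) := @Seminorm R _ mass
  (decomposition_normD simple_mass_ge0 mass_span)
  (decomposition_normZ simple_mass_ge0 mass_scal mass_span).

Lemma simple_mass_le alpha : simple_mass alpha <= mass alpha.
Proof.
apply: lb_le_inf; first exact: mass_span.
move=> _ [l [_ [-> ->]]]; elim/big_ind2: _ => //.
  by rewrite -[0](scale0r (0 : kvector R n k)) simple_massZ normr0 mul0r.
move=> x1 x2 y1 y2 h1 h2.
by apply: (le_trans (simple_massD _ _)); exact: lerD.
Qed.

Lemma mass_eq0 alpha : mass alpha = 0 -> alpha = 0.
Proof.
move=> a0; apply: kdot_eq0; apply/eqP.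
have := simple_mass_le alpha; rewrite a0 => h.
have /eqP : simple_mass alpha = 0 by apply/eqP; rewrite eq_le h sqrtr_ge0.
by rewrite sqrtr_eq0 eq_le kdot_ge0 andbT.
Qed.

Lemma massZ a alpha : mass (a *: alpha) = `|a| * mass alpha.
Proof. exact: (snZ mass_seminorm). Qed.

Lemma mass_simple alpha :
  simple_kvector alpha -> mass alpha = simple_mass alpha.
Proof.
move=> sa; apply/eqP; rewrite eq_le simple_mass_le andbT.
apply: ge_inf; first exact/decomposition_lb/simple_mass_ge0.
exists [:: alpha]; rewrite !big_seq1; split=> // b.
by rewrite inE => /eqP ->.
Qed.
End KVectors.

Section DiracChains.
Context {R : realType} {n k : nat}.
Implicit Types (p u : 'rV[R]_n) (alpha : kvector R n k).

Definition dot m (u v : 'rV[R]_m) : R := \sum_i u 0 i * v 0 i.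

(* The norm that 'rV[R]_m carries in the library is the sup norm. *)
Definition eucl_norm m (u : 'rV[R]_m) : R := Num.sqrt (dot u u).

Lemma kdot_wedge_gram (u v : 'M[R]_(k, n)) :
  kdot (wedge u) (wedge v) = \det (\matrix_(i, j) dot (row i u) (row j v)).
Proof.
rewrite kdot_wedge; congr (\det _); apply/matrixP => i j; rewrite !mxE.
by apply: eq_bigr => a _; rewrite !mxE.
Qed.

Definition finite_support_pred : {pred 'rV[R]_n -> kvector R n k} :=
  fun A => `[<finite_set [set p | A p != 0]>].

Fact finite_support_submod : submod_closed finite_support_pred.
Proof.
split.
  apply/asboolP; apply: (@sub_finite_set _ _ set0) => // p /=.
  by rewrite eqxx.
move=> a A B /asboolP fA /asboolP fB; apply/asboolP.
apply: (@sub_finite_set _ _ ([set p | A p != 0] `|` [set p | B p != 0])).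
  move=> p; rewrite /= !fctE.
  have [->|] := eqVneq (A p) 0; last by left.
  by have [->|] := eqVneq (B p) 0; [rewrite scaler0 addr0 eqxx|right].
by rewrite finite_setU.
Qed.
HB.instance Definition _ := GRing.isSubmodClosed.Build R
  ('rV[R]_n -> kvector R n k) finite_support_pred finite_support_submod.

Record dirac_chain := DiracChain {
  chain_fun :> 'rV[R]_n -> kvector R n k;
  chain_finite : chain_fun \in finite_support_pred }.
HB.instance Definition _ := [isSub for chain_fun].
HB.instance Definition _ := [Choice of dirac_chain by <:].
HB.instance Definition _ := [SubChoice_isSubLmodule of dirac_chain by <:].

Lemma dirac_chainP (A B : dirac_chain) : A =1 B -> A = B.
Proof. by move=> AB; apply/val_inj/funext. Qed.

Fact dirac_finite p alpha :
  (fun q => if q == p then alpha else 0) \in finite_support_pred.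
Proof.
apply/asboolP; apply: (@sub_finite_set _ _ [set p]) => // q /=.
by case: (q =P p) => //; rewrite eqxx.
Qed.

Definition dirac p alpha : dirac_chain := DiracChain (dirac_finite p alpha).

Fact translate_finite u (A : dirac_chain) :
  (fun q => A (q - u)) \in finite_support_pred.
Proof.
have /asboolP fA := chain_finite A; apply/asboolP.
apply: (@sub_finite_set _ _ ((fun q => q + u) @` [set p | A p != 0])).
  by move=> q /= h; exists (q - u); rewrite ?subrK.
exact: finite_image.
Qed.

Definition translate u (A : dirac_chain) : dirac_chain :=
  DiracChain (translate_finite u A).

Lemma translate_dirac u p alpha :
  translate u (dirac p alpha) = dirac (p + u) alpha.
Proof. by apply: dirac_chainP => q /=; rewrite subr_eq. Qed.

(* A symmetric product u_1 o ... o u_j is represented by any list of its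
   factors. *)
Definition Delta (sigma : seq 'rV[R]_n) p alpha : dirac_chain :=
  foldr (fun u A => translate u A - A) (dirac p alpha) sigma.

Definition sym_norm (sigma : seq 'rV[R]_n) : R :=
  \prod_(u <- sigma) eucl_norm u.

Definition difference : Type := (seq 'rV[R]_n * 'rV[R]_n * kvector R n k)%type.

Definition difference_chain (d : difference) : dirac_chain :=
  Delta d.1.1 d.1.2 d.2.

Definition difference_cost (d : difference) : R := sym_norm d.1.1 * mass d.2.

Definition difference_order (r : nat) : set difference :=
  [set d | (size d.1.1 <= r)%N].

Definition Bnorm (r : nat) : dirac_chain -> R :=
  decomposition_norm (difference_order r) difference_chain difference_cost.

Fact translate_linear u : linear (translate u).
Proof. by move=> a A B; apply: dirac_chainP. Qed.

Fact dirac_linear p : linear (dirac p).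
Proof.
move=> a x y; apply: dirac_chainP => q; rewrite /= !fctE /=.
by case: eqP => // _; rewrite scaler0 addr0.
Qed.

Lemma DeltaZ sigma p a alpha :
  Delta sigma p (a *: alpha) = a *: Delta sigma p alpha.
Proof.
elim: sigma => [|u s IH] /=.
  have := dirac_linear p a alpha 0; rewrite addr0 => ->.
  rewrite (_ : dirac p 0 = 0) ?addr0//.
  by apply: dirac_chainP => q /=; case: ifP.
rewrite IH scalerBr; congr (_ - _).
by apply: dirac_chainP.
Qed.

Lemma dirac_chain_sum (A : dirac_chain) :
  A = \sum_(p <- fset_set [set p | A p != 0]) dirac p (A p).
Proof.
have /asboolP fA := chain_finite A.
have sumE (s : seq 'rV[R]_n) (F : 'rV[R]_n -> dirac_chain) q :
    (\sum_(p <- s) F p : dirac_chain) q = \sum_(p <- s) F p q.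
  by elim: s => [|x s IH]; rewrite ?big_nil// !big_cons -IH.
apply: dirac_chainP => q; rewrite sumE.
have [q0|q0] := eqVneq (A q) 0.
  rewrite q0 big1_seq// => p _ /=; by case: eqP => // <-.
rewrite (big_fsetD1 q)/=; last by rewrite in_fset_set//; exact: mem_set.
rewrite eqxx big1_seq ?addr0// => p /andP[_].
rewrite in_fsetD1 => /andP[pq _] /=.
by rewrite eq_sym (negbTE pq).
Qed.

Fact eucl_norm_ge0 m (u : 'rV[R]_m) : 0 <= eucl_norm u.
Proof. exact: sqrtr_ge0. Qed.

Fact difference_cost_ge0 d : 0 <= difference_cost d.
Proof.
apply: mulr_ge0; last exact: (sn_ge0 mass_seminorm).
by apply: prodr_ge0 => u _; exact: eucl_norm_ge0.
Qed.

Fact difference_scal r a d : difference_order r d ->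
  exists2 d', difference_order r d' &
    difference_chain d' = a *: difference_chain d /\
    difference_cost d' = `|a| * difference_cost d.
Proof.
case: d => [[s p] alpha] /= sr; exists ((s, p), a *: alpha) => //.
split; first exact: DeltaZ.
by rewrite /difference_cost/= massZ mulrCA.
Qed.

Fact difference_span r A :
  decompositions (difference_order r) difference_chain difference_cost A !=set0.
Proof.
pose l : seq difference := map (fun p => ([::], p, A p))
  (fset_set [set p | A p != 0]).
exists (\sum_(d <- l) difference_cost d), l; split; last split=> //.
  by move=> _ /mapP[p _ ->].
by rewrite /l big_map [LHS]dirac_chain_sum.
Qed.

Definition Bseminorm (r : nat) : seminorm dirac_chain := @Seminorm R _ (Bnorm r)
  (decomposition_normD difference_cost_ge0 (@difference_span r))
  (decomposition_normZ difference_cost_ge0 (@difference_scal r)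
    (@difference_span r)).

End DiracChains.
Arguments dirac_chain : clear implicits.
Arguments Bseminorm : clear implicits.

Section Forms.
Context {R : realType} {n k : nat}.

Definition form_seminorm (j : nat) (omega : {scalar dirac_chain R n k}) :
    \bar R :=
  ereal_sup [set x | exists (sigma : seq 'rV[R]_n) p (alpha : kvector R n k),
    size sigma = j /\ sym_norm sigma * mass alpha = 1 /\
    x = `|omega (Delta sigma p alpha)|%:E].

(* The 0 only matters when all the sups are over the empty set. *)
Definition form_norm (r : nat) (omega : {scalar dirac_chain R n k}) : \bar R :=
  \big[maxe/0%E]_(j < r.+1) form_seminorm j omega.

Lemma Delta_eq0 sigma p (alpha : kvector R n k) :
  sym_norm sigma * mass alpha = 0 -> Delta sigma p alpha = 0.
Proof.
move=> /eqP; rewrite mulf_eq0 => /orP[|/eqP/mass_eq0 ->]; last first.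
  by have := DeltaZ sigma p 0 (0 : kvector R n k); rewrite !scale0r.
have t0 u : translate u 0 = 0 :> dirac_chain R n k by exact: dirac_chainP.
rewrite /sym_norm; elim: sigma => [|u s IH].
  by rewrite big_nil oner_eq0.
rewrite big_cons mulf_eq0 => /orP[|/IH h]; last first.
  by rewrite /Delta /= -/(Delta s p alpha) h t0 subrr.
rewrite sqrtr_eq0 => u0.
have {}u0 : u = 0.
  have h i : 0 <= u 0 i * u 0 i by rewrite -expr2 sqr_ge0.
  have /eqP : dot u u = 0 by apply/eqP; rewrite eq_le u0 sumr_ge0.
  rewrite psumr_eq0// => /allP H; apply/rowP => i; rewrite mxE; apply/eqP.
  by have := H i (mem_index_enum i); rewrite /= mulf_eq0 orbb.
rewrite /Delta /= u0; apply/eqP; rewrite subr_eq0; apply/eqP.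
by apply: dirac_chainP => q /=; rewrite subr0.
Qed.

Definition Bform (r : nat) : set {scalar dirac_chain R n k} :=
  [set omega | (form_norm r omega < +oo)%E].

Lemma form_bounded r omega : Bform r omega ->
  exists C : R, forall A, `|omega A| <= C * Bseminorm R n k r A.
Proof.
move=> /= fin.
have [C C0 HC] : exists2 C : R, 0 < C & forall d, difference_order r d ->
    `|omega (difference_chain d)| <= C * difference_cost d.
  pose C := fine (form_norm r omega).
  have ge0 : (0 <= form_norm r omega)%E.
    by rewrite /form_norm; elim/big_rec: _ => // j x _ h; rewrite le_max h orbT.
  have CE : form_norm r omega = C%:E by rewrite fineK// ge0_fin_numE.
  exists (C + 1); first by rewrite ltr_wpDl// fine_ge0.
  move=> [[s p] alpha] /= sr; rewrite /difference_cost /difference_chain /=.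
  have [c0|c0] := eqVneq (sym_norm s * mass alpha) 0.
    by rewrite c0 (Delta_eq0 p c0) linear0 normr0 mulr0.
  have cp : 0 < sym_norm s * mass alpha.
    by rewrite lt_def c0; exact: (difference_cost_ge0 (s, p, alpha)).
  rewrite -ler_pdivrMr//; apply: (@le_trans _ _ C); last by rewrite lerDl.
  rewrite -lee_fin -CE.
  apply: (@le_trans _ _ (form_seminorm (size s) omega)); last first.
    have sr' : (size s < r.+1)%N by [].
    exact: (le_bigmax 0%E (fun j : 'I_r.+1 => form_seminorm j omega)
      (Ordinal sr')).
  apply: ereal_sup_ubound; exists s, p, ((sym_norm s * mass alpha)^-1 *: alpha).
  split=> //; rewrite massZ DeltaZ linearZ /= normrM ger0_norm ?invr_ge0 ?ltW//.
  by rewrite mulrCA mulVf// mulrC.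
exists C => A; rewrite -ler_pdivrMl//.
apply: lb_le_inf; first exact: difference_span.
move=> _ [l [lr [-> ->]]]; rewrite ler_pdivrMl// linear_sum big_distrr /=.
apply: (le_trans (ler_norm_sum _ _ _)).
by rewrite !big_seq; apply: ler_sum => d dl; exact/HC/lr.
Qed.

End Forms.

(* Bchain R n k r is the Banach space of differential k-chains of class B^r. *)
Definition Bchain (R : realType) (n k r : nat) : completeNormedModType R :=
  completion (Bseminorm R n k r).

(* For omega in Bform 1 the limit exists and does not depend on the sequence of
   Dirac chains tending to J: see chain_integral_cvg. *)
Definition chain_integral (R : realType) (n k : nat) (J : Bchain R n k 1)
    (omega : {scalar dirac_chain R n k}) : R :=
  lim (omega (crep J i) @[i --> \oo]).

(* The continuous extension of the identity of Dirac chains, for 1 <= r: see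
   Bchain_incl_cvg. *)
Definition Bchain_incl (R : realType) (n k r : nat) (J : Bchain R n k 1) :
    Bchain R n k r :=
  lim (embed (Bseminorm R n k r) (crep J i) @[i --> \oo]).

Lemma chain_integral_cvg (R : realType) (n k : nat) (J : Bchain R n k 1)
    (omega : {scalar dirac_chain R n k}) (A : nat -> dirac_chain R n k) :
  Bform 1 omega -> embed (Bseminorm R n k 1) (A i) @[i --> \oo] --> J ->
  omega (A i) @[i --> \oo] --> chain_integral J omega.
Proof.
move=> /form_bounded[C HC].
exact: (@crep_bounded_cvg _ _ _ R omega C (raddfB omega) HC).
Qed.

Lemma Bseminorm_le (R : realType) (n k r s : nat) A : (r <= s)%N ->
  Bseminorm R n k s A <= Bseminorm R n k r A.
Proof.
move=> rs; apply: lb_le_inf; first exact: difference_span.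
move=> _ [l [lr [-> ->]]].
apply: ge_inf; first exact/decomposition_lb/difference_cost_ge0.
by exists l; split=> // d /lr dr; exact: leq_trans dr rs.
Qed.

Lemma Bchain_incl_cvg (R : realType) (n k r : nat) (J : Bchain R n k 1)
    (A : nat -> dirac_chain R n k) : (1 <= r)%N ->
  embed (Bseminorm R n k 1) (A i) @[i --> \oo] --> J ->
  embed (Bseminorm R n k r) (A i) @[i --> \oo] --> Bchain_incl r J.
Proof.
move=> r1; apply: (@crep_bounded_cvg _ _ _ (Bchain R n k r)
  (embed (Bseminorm R n k r)) 1); first exact: raddfB.
by move=> v; rewrite mul1r norm_embed; exact: Bseminorm_le.
Qed.

Section RiemannIntegral.
Context {R : realType} {k : nat}.
Implicit Types (a b : 'rV[R]_k) (f : 'rV[R]_k -> R) (C : set 'rV[R]_k).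

Definition box a b : set 'rV[R]_k :=
  [set t | forall i, a 0 i <= t 0 i <= b 0 i].

(* Tagged grid partitions of the box: x i 0 <= ... <= x i m cuts the i-th side.
   Cut points may be repeated, so using the same m on every side is harmless. *)
Definition is_riemann_integral_box a b f (v : R) := forall e : R, 0 < e ->
  exists2 d : R, 0 < d &
    forall (m : nat) (x : 'I_k -> nat -> R)
        (t : {ffun 'I_k -> 'I_m} -> 'rV[R]_k),
      (forall i, x i 0%N = a 0 i /\ x i m = b 0 i) ->
      (forall i j, (j < m)%N -> 0 <= x i j.+1 - x i j < d) ->
      (forall (J : {ffun 'I_k -> 'I_m}) i,
        x i (J i) <= t J 0 i <= x i (J i).+1) ->
      `|\sum_J f (t J) * \prod_i (x i (J i).+1 - x i (J i)) - v| < e.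

Definition is_riemann_integral C f (v : R) := exists a b,
  (forall i, a 0 i <= b 0 i) /\ C `<=` box a b /\
  is_riemann_integral_box a b (f \_ C) v.

Definition half_space (H : set 'rV[R]_k) := exists (a : 'rV[R]_k) (c : R),
  a != 0 /\ (H = [set t | dot a t <= c] \/ H = [set t | dot a t < c]).

Definition affine_cell C := exists (m : nat) (H : 'I_m -> set 'rV[R]_k),
  (forall i, half_space (H i)) /\ C = \bigcap_i H i /\
  compact (closure C) /\ (open C \/ closed C).

End RiemannIntegral.

(* An affine k-cell of R^n sits in a k-dimensional affine subspace, which is
   given here by an affine chart t |-> origin + t *m frame from R^k; the cell is
   the image of an affine k-cell of R^k, and the ordered basis of the direction
   formed by the rows of the frame is its orientation. *)
Record oriented_cell (R : realType) (n k : nat) := OrientedCell {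
  cell_origin : 'rV[R]_n;
  cell_frame : 'M[R]_(k, n);
  cell_frame_free : row_free cell_frame;
  cell_domain : set 'rV[R]_k;
  cell_domainP : affine_cell cell_domain }.

Section PolyhedralChains.
Context {R : realType} {n k : nat}.

(* The integral of the pullback of omega by the chart. *)
Definition is_cell_integral (Q : oriented_cell R n k)
    (omega : {scalar dirac_chain R n k}) (v : R) :=
  is_riemann_integral (cell_domain Q)
    (fun t => omega (dirac (cell_origin Q + t *m cell_frame Q)
                           (wedge (cell_frame Q)))) v.

(* J is the chain associated with the oriented cell Q. *)
Definition represents_cell (Q : oriented_cell R n k) (J : Bchain R n k 1) :=
  forall omega, Bform 1 omega ->
    is_cell_integral Q omega (chain_integral J omega).

Definition polyhedral_chain : set (Bchain R n k 1) :=
  [set P | exists (m : nat) (a : 'I_m -> R) (Q : 'I_m -> oriented_cell R n k)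
             (J : 'I_m -> Bchain R n k 1),
    (forall i, represents_cell (Q i) (J i)) /\ P = \sum_i a i *: J i].

End PolyhedralChains.

(* Main.v *)
From HB Require Import structures.
Require Import Defs.
From mathcomp Require Import all_boot all_order all_algebra.
From mathcomp Require Import all_classical all_reals all_analysis.
From mathcomp Require Import lra.

(** A Dirac chain (p; alpha) is the limit of normalized cells that shrink to p,
    and Dirac chains are dense in the completion for B^r.

    The work lies in producing the chain of a cell, and cubes suffice.  Fix a
    point p and a frame F.  Moving a Dirac chain by u costs at most
    |u| |alpha| in the B^1 norm, as the move is a difference chain of order 1
    (Bnorm_translation).  So t |-> (p + t F; wedge F) is a Lipschitz map from
    R^k to Dirac chains, and its Riemann sums over a cube, which are Dirac
    chains themselves, satisfy one estimate: two sums over tagged grids of mesh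
    d and d' are at B^1 distance at most L (d + d') times the volume
    (riemann_sum_dist).  That estimate is used three times.
    - Between two uniform grids, it shows that their sums are Cauchy; they have
      a limit J, at distance at most L d times the volume from every sum of
      mesh d (cube_integral).
    - A form omega in B^1 is bounded for the B^1 norm and maps these sums to the
      Riemann sums of the pullback of omega.  Hence J represents the cube.
    - The grid with one cell, tagged at p, has Riemann sum h^k (p; wedge F) and
      mesh h.  Hence h^(-k) J is within L h of (p; wedge F).
    The last two points are cube_chain.

    Every Dirac chain is a finite linear combination of chains
    (p; e_I) with e_I an exterior product of basis vectors, and these are limits
    of multiples of cubes with frame e_I.  Polyhedral chains therefore
    approximate every Dirac chain in B^1 (polyhedral_limit_embed), and a
    fortiori in B^r, as the map from B^1 to B^r does not increase distances to
    Dirac chains (Bchain_incl_dist). *)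

Set Implicit Arguments.
Unset Strict Implicit.
Unset Printing Implicit Defensive.

Local Open Scope classical_set_scope.
Local Open Scope ring_scope.

Import Order.TTheory GRing.Theory Num.Theory numFieldNormedType.Exports.

(** * Riemann sums with values in a seminormed space *)

Lemma sn_sum (R : realType) (V : lmodType R) (N : seminorm V) (I : Type)
    (s : seq I) (P : pred I) (F : I -> V) :
  N (\sum_(i <- s | P i) F i) <= \sum_(i <- s | P i) N (F i).
Proof.
elim/big_rec2: _ => [|i y x _ h]; first by rewrite sn0.
by apply: le_trans (snD _ _ _) _; rewrite lerD2l.
Qed.

Section Overlap.
Context {R : realType}.
Implicit Types p q r s : R.

Definition clamp p q r : R := Num.max p (Num.min q r).

(** The length of the intersection of [p, q] and [r, s].  Written as an
    increment of clamp p q, it telescopes when [r, s] runs over the cells of a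
    subdivision; the symmetry between the two intervals becomes a lemma. *)
Definition overlap p q r s : R := clamp p q s - clamp p q r.

Lemma overlap_sym p q r s : p <= q -> r <= s ->
  overlap p q r s = overlap r s p q.
Proof.
rewrite /overlap /clamp => pq rs.
by case: (leP q s); case: (leP q r); case: (leP p s); case: (leP p r);
  rewrite ?(max_idPr pq) ?(max_idPr rs); lra.
Qed.

Lemma overlap_ge0 p q r s : r <= s -> 0 <= overlap p q r s.
Proof.
move=> rs; rewrite subr_ge0 /clamp ge_max !le_max lexx/=.
by rewrite le_min !ge_min lexx rs !orbT.
Qed.

Lemma overlap_neq0 p q r s : p <= q -> r <= s -> overlap p q r s != 0 ->
  p <= s /\ r <= q.
Proof.
move=> pq rs h; split; rewrite leNgt; apply/negP => lt; move/eqP: h; apply.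
  rewrite /overlap /clamp !(min_idPr _) ?(max_idPl _) ?subrr//; lra.
by rewrite /overlap /clamp !(min_idPl _) ?subrr//; lra.
Qed.

Lemma sum_overlap p q (m : nat) (y : nat -> R) :
  y 0%N <= p -> p <= q -> q <= y m ->
  \sum_(j < m) overlap p q (y j) (y j.+1) = q - p.
Proof.
move=> yp pq qy.
rewrite -(big_mkord xpredT (fun j => overlap p q (y j) (y j.+1))).
rewrite (telescope_sumr (fun j => clamp p q (y j)))//.
rewrite /clamp (min_idPl qy) (max_idPr pq).
by rewrite (min_idPr (le_trans yp pq)) (max_idPl yp).
Qed.

End Overlap.

Section RiemannSums.
Context {R : realType} {k : nat}.
Implicit Types (a b : 'rV[R]_k) (d : R) (x y : 'I_k -> nat -> R).

Definition tagged_grid (a b : 'rV[R]_k) (d : R) (m : nat) (x : 'I_k -> nat -> R)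
    (t : {ffun 'I_k -> 'I_m} -> 'rV[R]_k) :=
  [/\ forall i, x i 0%N = a 0 i /\ x i m = b 0 i,
      forall i j, (j < m)%N -> 0 <= x i j.+1 - x i j <= d &
      forall (J : {ffun 'I_k -> 'I_m}) i, x i (J i) <= t J 0 i <= x i (J i).+1].

Definition riemann_sum (V : lmodType R) (g : 'rV[R]_k -> V) (m : nat)
    (x : 'I_k -> nat -> R) (t : {ffun 'I_k -> 'I_m} -> 'rV[R]_k) : V :=
  \sum_(J : {ffun 'I_k -> 'I_m})
    (\prod_i (x i (J i).+1 - x i (J i))) *: g (t J).

(** The domain is measured coordinate by coordinate, as the mesh of a grid is. *)
Definition sup_lipschitz (V : lmodType R) (N : seminorm V) (L : R)
    (g : 'rV[R]_k -> V) :=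
  forall (s t : 'rV[R]_k) (e : R), (forall i, `|s 0 i - t 0 i| <= e) ->
    N (g s - g t) <= L * e.

Lemma tagged_grid_cut a b d m x t i j : @tagged_grid a b d m x t ->
  (j <= m)%N -> a 0 i <= x i j <= b 0 i.
Proof.
move=> [/(_ i)[xa xb] /(_ i) xd _] jm.
have mono l : (j + l <= m)%N -> x i j <= x i (j + l)%N.
  elim: l => [|l IH]; first by rewrite addn0.
  rewrite addnS => h; apply: le_trans (IH (ltnW h)) _.
  by have /andP[] := xd _ h; rewrite subr_ge0.
have := mono (m - j)%N; rewrite subnKC// xb => /(_ (leqnn _)) ->.
rewrite andbT -xa; elim: j jm {mono} => // j IH h.
apply: le_trans (IH (ltnW h)) _.
by have /andP[] := xd _ h; rewrite subr_ge0.
Qed.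

Lemma tagged_grid_tag a b d m x t J : @tagged_grid a b d m x t ->
  box a b (t J).
Proof.
move=> G i; have [_ _ /(_ J i)/andP[h1 h2]] := G.
have /andP[+ _] := tagged_grid_cut i G (ltnW (ltn_ord (J i))).
have /andP[_] := tagged_grid_cut i G (ltn_ord (J i)).
by move=> h3 h4; rewrite (le_trans h4 h1) (le_trans h2 h3).
Qed.

(** The volume of the intersection of the cell I of the grid x with the cell J
    of the grid y. *)
Definition cell_overlap (m m' : nat) (x y : 'I_k -> nat -> R)
    (I : {ffun 'I_k -> 'I_m}) (J : {ffun 'I_k -> 'I_m'}) : R :=
  \prod_i overlap (x i (I i)) (x i (I i).+1) (y i (J i)) (y i (J i).+1).

(** The cells of y tile the box, hence also each cell of x.  The product over
    the sides of the one-dimensional statement expands into a sum over cells. *)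
Lemma cell_overlap_sum a b d d' m m' x y t t' (I : {ffun 'I_k -> 'I_m}) :
  @tagged_grid a b d m x t -> @tagged_grid a b d' m' y t' ->
  \prod_i (x i (I i).+1 - x i (I i)) =
  \sum_(J : {ffun 'I_k -> 'I_m'}) cell_overlap x y I J.
Proof.
move=> gx gy; rewrite -(bigA_distr_bigA (fun i (j : 'I_m') =>
  overlap (x i (I i)) (x i (I i).+1) (y i j) (y i j.+1))).
apply: eq_bigr => i _; rewrite sum_overlap//.
- have [/(_ i)[-> _] _ _] := gy.
  by have /andP[] := tagged_grid_cut i gx (ltnW (ltn_ord (I i))).
- have [_ /(_ i _ (ltn_ord (I i)))/andP[+ _] _] := gx.
  by rewrite subr_ge0.
- have [/(_ i)[_ ->] _ _] := gy.
  by have /andP[] := tagged_grid_cut i gx (ltn_ord (I i)).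
Qed.

Lemma tagged_grid_volume a b d m x t :
  @tagged_grid a b d m x t ->
  \sum_(J : {ffun 'I_k -> 'I_m}) \prod_i (x i (J i).+1 - x i (J i)) =
  \prod_i (b 0 i - a 0 i).
Proof.
move=> [xab _ _].
rewrite -(bigA_distr_bigA (fun i (j : 'I_m) => x i j.+1 - x i j)).
apply: eq_bigr => i _.
rewrite -(big_mkord xpredT (fun j => x i j.+1 - x i j)) telescope_sumr//.
by have [-> ->] := xab i.
Qed.

(** Both sums are rewritten over the pairs (I, J) of cells, with the volume of
    the common part as weight.  When it is nonzero the two cells meet, so their
    tags are within d + d' of each other on every coordinate.  This plays the
    role of a common refinement without constructing one. *)
Lemma riemann_sum_dist (V : lmodType R) (N : seminorm V) (L : R)
    (g : 'rV[R]_k -> V) a b d d' m m' x y t t' :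
  sup_lipschitz N L g ->
  @tagged_grid a b d m x t -> @tagged_grid a b d' m' y t' ->
  N (riemann_sum g x t - riemann_sum g y t') <=
    \prod_i (b 0 i - a 0 i) * (L * (d + d')).
Proof.
move=> gL gx gy.
have step (z : 'I_k -> nat -> R) e l s (gz : @tagged_grid a b e l z s)
    (J : {ffun 'I_k -> 'I_l}) i : z i (J i) <= z i (J i).+1.
  have [_ /(_ i _ (ltn_ord (J i)))/andP[+ _] _] := gz.
  by rewrite subr_ge0.
have sx : riemann_sum g x t =
    \sum_(I : {ffun 'I_k -> 'I_m}) \sum_(J : {ffun 'I_k -> 'I_m'})
      cell_overlap x y I J *: g (t I).
  by apply: eq_bigr => I _; rewrite (cell_overlap_sum _ gx gy) scaler_suml.
have sy : riemann_sum g y t' =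
    \sum_(I : {ffun 'I_k -> 'I_m}) \sum_(J : {ffun 'I_k -> 'I_m'})
      cell_overlap x y I J *: g (t' J).
  rewrite exchange_big; apply: eq_bigr => J _.
  rewrite (cell_overlap_sum _ gy gx) scaler_suml; apply: eq_bigr => I _.
  congr (_ *: _); apply: eq_bigr => i _; rewrite overlap_sym//.
    exact: step gy J i.
  exact: step gx I i.
rewrite sx sy -sumrB -(tagged_grid_volume gx) mulr_suml.
apply: le_trans (sn_sum _ _ _ _) _; apply: ler_sum => I _.
rewrite (cell_overlap_sum _ gx gy) mulr_suml -sumrB.
apply: le_trans (sn_sum _ _ _ _) _; apply: ler_sum => J _.
rewrite -scalerBr snZ ger0_norm; last first.
  by apply: prodr_ge0 => i _; apply: overlap_ge0; exact: step gy J i.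
have [->|] := eqVneq (cell_overlap x y I J) 0; first by rewrite !mul0r.
move=> /prodf_neq0 nz; apply: ler_wpM2l.
  by apply: prodr_ge0 => i _; apply: overlap_ge0; exact: step gy J i.
apply: gL => i.
have := overlap_neq0 (step _ _ _ _ gx I i) (step _ _ _ _ gy J i) (nz i isT).
have [_ /(_ i _ (ltn_ord (I i)))/andP[_ h1] /(_ I i)/andP[h2 h3]] := gx.
have [_ /(_ i _ (ltn_ord (J i)))/andP[_ h4] /(_ J i)/andP[h5 h6]] := gy.
by move=> [h7 h8]; rewrite ler_norml; apply/andP; split; lra.
Qed.

End RiemannSums.

(** * Limits of Dirac chains in the completion *)

(** The estimate holds along a sequence of Dirac chains tending to J, and both
    sides pass to the limit; likewise for Bchain_incl_dist. *)
Lemma chain_integral_dist (R : realType) (n k : nat)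
    (omega : {scalar dirac_chain R n k}) (C : R) (J : Bchain R n k 1)
    (A : dirac_chain R n k) :
  Bform 1 omega -> (forall B, `|omega B| <= C * Bseminorm R n k 1 B) ->
  `|chain_integral J omega - omega A| <=
    C * `|J - embed (Bseminorm R n k 1) A|.
Proof.
move=> oB oC.
have h1 : `|omega (crep J i) - omega A| @[i --> \oo] -->
    `|chain_integral J omega - omega A|.
  apply: cvg_norm; apply: cvgB; last exact: cvg_cst.
  exact: (chain_integral_cvg oB (@crep_cvg _ _ _ J)).
have h2 : C * `|embed (Bseminorm R n k 1) (crep J i) -
    embed (Bseminorm R n k 1) A| @[i --> \oo] -->
    C * `|J - embed (Bseminorm R n k 1) A|.
  apply: cvgMl_tmp; apply: cvg_norm; apply: cvgB; last exact: cvg_cst.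
  exact: crep_cvg.
apply: (ler_cvg_to h1 h2); near=> i.
by rewrite -!raddfB norm_embed; exact: oC.
Unshelve. all: by end_near. Qed.

Lemma Bchain_incl_dist (R : realType) (n k r : nat) (J : Bchain R n k 1)
    (A : dirac_chain R n k) : (1 <= r)%N ->
  `|Bchain_incl r J - embed (Bseminorm R n k r) A| <=
    `|J - embed (Bseminorm R n k 1) A|.
Proof.
move=> r1.
have h1 : `|embed (Bseminorm R n k r) (crep J i) -
    embed (Bseminorm R n k r) A| @[i --> \oo] -->
    `|Bchain_incl r J - embed (Bseminorm R n k r) A|.
  apply: cvg_norm; apply: cvgB; last exact: cvg_cst.
  exact: (Bchain_incl_cvg r1 (@crep_cvg _ _ _ J)).
have h2 : `|embed (Bseminorm R n k 1) (crep J i) -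
    embed (Bseminorm R n k 1) A| @[i --> \oo] -->
    `|J - embed (Bseminorm R n k 1) A|.
  apply: cvg_norm; apply: cvgB; last exact: cvg_cst.
  exact: crep_cvg.
apply: (ler_cvg_to h1 h2); near=> i.
by rewrite -!raddfB !norm_embed; exact: Bseminorm_le.
Unshelve. all: by end_near. Qed.

(** * The chain of a cube *)

Section CubeIntegral.
Context {R : realType} {k : nat} (h : R) (h_ge0 : 0 <= h).

Let grid_cut (m : nat) (i : 'I_k) (j : nat) : R := h * (j%:R / m.+1%:R).

Let grid_tag (m : nat) (J : {ffun 'I_k -> 'I_m.+1}) : 'rV[R]_k :=
  \row_i grid_cut m i (J i).

Lemma uniform_grid m :
  tagged_grid 0 (const_mx h) (h / m.+1%:R) (grid_cut m) (@grid_tag m).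
Proof.
split=> [i|i j jm|J i].
- by rewrite /grid_cut !mxE mul0r mulr0 divff ?mulr1// pnatr_eq0.
- rewrite /grid_cut -mulrBr -mulrBl -natrB// subSnn mul1r lexx andbT.
  by rewrite mulr_ge0// invr_ge0.
- by rewrite mxE lexx ler_wpM2l// ler_wpM2r ?invr_ge0// ler_nat.
Qed.

Context {V : lmodType R} {N : seminorm V} {L : R} {g : 'rV[R]_k -> V}.
Hypothesis L_ge0 : 0 <= L.
Hypothesis gL : sup_lipschitz N L g.

Let cube_volume :
  \prod_(i < k) ((const_mx h : 'rV[R]_k) 0 i - (0 : 'rV[R]_k) 0 i) = h ^+ k.
Proof.
under eq_bigr do rewrite !mxE subr0.
by rewrite prodr_const card_ord.
Qed.

(** The integral of g over the cube [0, h]^k, as an element of the completion.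
    The bound in terms of d, for all tagged grids, is what makes the integral
    independent of the grids that define it. *)
Lemma cube_integral : exists J : completion N,
  forall d (m : nat) x (t : {ffun 'I_k -> 'I_m} -> 'rV[R]_k),
    tagged_grid 0 (const_mx h) d x t ->
    `|J - embed N (riemann_sum g x t)| <= h ^+ k * (L * d).
Proof.
pose A m := riemann_sum g (grid_cut m) (@grid_tag m).
pose K := h ^+ k * L * h.
have K0 : 0 <= K by rewrite !mulr_ge0// exprn_ge0.
have small e : 0 < e -> \forall i \near \oo, K / i.+1%:R < e.
  move=> e0; have K1 : 0 < K + 1 by rewrite ltr_wpDl.
  (* Dividing by K + 1 rather than K covers K = 0. *)
  have := near_infty_natSinv_lt (PosNum (divr_gt0 e0 K1)).
  apply: filterS => i /=; rewrite ltr_pdivlMr// => /(le_lt_trans _); apply.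
  by rewrite mulrC ler_wpM2l ?invr_ge0// lerDl.
have AC : A \in cauchy_pred N.
  apply/asboolP => e e0.
  have [M _ hM] := small _ (divr_gt0 e0 (ltr0n _ 2)).
  exists M => i j /hM /= hi /hM /= hj.
  have := riemann_sum_dist gL (uniform_grid i) (uniform_grid j).
  rewrite cube_volume => /le_lt_trans; apply.
  rewrite [e]splitr; apply: le_lt_trans (ltrD hi hj).
  by rewrite /K !mulrDr !mulrA.
exists (cclass (CauchySeqs AC)) => d m x t G.
apply/ler_addgt0Pr => e e0.
have /cvgrPdist_lt/(_ _ (divr_gt0 e0 (ltr0n _ 2))) h1 :=
  @embed_cvg _ _ _ (CauchySeqs AC).
have h2 := small _ (divr_gt0 e0 (ltr0n _ 2)).
have [i [/= {}h1 {}h2]] := filter_ex (filterI h1 h2).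
apply: le_trans (ler_distD (embed N (A i)) _ _) _.
have h3 : `|embed N (A i) - embed N (riemann_sum g x t)| <=
    K / i.+1%:R + h ^+ k * (L * d).
  rewrite -raddfB norm_embed.
  have := riemann_sum_dist gL (uniform_grid i) G.
  by rewrite cube_volume /K !mulrDr !mulrA.
rewrite [leRHS]addrC [e]splitr -addrA.
apply: le_trans (lerD (ltW h1) h3) _.
by rewrite lerD2l lerD2r ltW.
Qed.

End CubeIntegral.

Section Cells.
Context {R : realType} {n k : nat}.
Implicit Types (F : 'M[R]_(k, n)) (p : 'rV[R]_n).

Lemma eucl_norm_le_sum (u : 'rV[R]_n) : eucl_norm u <= \sum_j `|u 0 j|.
Proof.
have S0 : 0 <= \sum_j `|u 0 j| by exact: sumr_ge0.
rewrite /eucl_norm -(ger0_norm S0) -sqrtr_sqr ler_sqrt ?sqr_ge0//.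
rewrite /dot expr2 mulr_suml; apply: ler_sum => j _.
apply: le_trans (ler_norm _) _; rewrite normrM ler_wpM2l//.
by rewrite (bigD1 j)//= lerDl sumr_ge0.
Qed.

(** The difference of the two chains is Delta_u (q; alpha) with u = p - q, a
    decomposition with a single term. *)
Lemma Bnorm_translation (r : nat) (p q : 'rV[R]_n) (alpha : kvector R n k) :
  (1 <= r)%N ->
  Bseminorm R n k r (Defs.dirac p alpha - Defs.dirac q alpha) <=
    eucl_norm (p - q) * mass alpha.
Proof.
move=> r1; apply: ge_inf; first exact/decomposition_lb/difference_cost_ge0.
exists [:: ([:: p - q], q, alpha)]; split.
  by move=> d; rewrite inE => /eqP ->.
rewrite !big_seq1 /difference_chain /difference_cost /sym_norm /= big_seq1.
by split=> //; rewrite translate_dirac (addrC q) subrK.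
Qed.

Lemma frame_lipschitz p F (alpha : kvector R n k) :
  sup_lipschitz (Bseminorm R n k 1)
    ((\sum_j \sum_i `|F i j|) * mass alpha)
    (fun t => Defs.dirac (p + t *m F) alpha).
Proof.
move=> s t e st; apply: le_trans (Bnorm_translation _ _ _ _) _ => //.
rewrite mulrAC ler_wpM2r ?(sn_ge0 mass_seminorm)//.
rewrite opprD addrACA subrr add0r -mulmxBl.
apply: le_trans (eucl_norm_le_sum _) _; rewrite mulr_suml.
apply: ler_sum => j _; rewrite mxE mulr_suml.
apply: le_trans (ler_norm_sum _ _ _) _; apply: ler_sum => i _.
by rewrite normrM mulrC ler_wpM2l// !mxE.
Qed.

Lemma half_space_closed (a : 'rV[R]_k) (c : R) :
  closed [set t : 'rV[R]_k | dot a t <= c].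
Proof.
apply: (@closed_comp _ _ (dot a) [set x | x <= c]); last exact: closed_le.
move=> t _; apply: continuous_big => [|i _ s]; first exact: add_continuous.
apply: (@cvgMl_tmp _ _ (nbhs s)); exact: coord_continuous.
Qed.

(** Two half spaces for each side.  For k = 0 there is none, and the box is the
    whole space, a point. *)
Lemma box_affine_cell (a b : 'rV[R]_k) : affine_cell (box a b).
Proof.
pose e (i : 'I_k) : 'rV[R]_k := delta_mx 0 i.
have dote i t : dot (e i) t = t 0 i.
  rewrite /dot (bigD1 i)//= big1 ?addr0 => [|j ji]; rewrite mxE.
    by rewrite !eqxx mul1r.
  by rewrite (negbTE ji) andbF mul0r.
have dotNe i t : dot (- e i) t = - t 0 i.
  rewrite -dote /dot -sumrN; apply: eq_bigr => j _.
  by rewrite [in LHS]mxE mulNr.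
have e0 i : e i != 0.
  apply/eqP => /rowP/(_ i); rewrite !mxE !eqxx; exact/eqP/oner_neq0.
pose H (l : 'I_(k + k)) : set 'rV[R]_k := match fintype.split l with
  | inl i => [set t | dot (- e i) t <= - a 0 i]
  | inr i => [set t | dot (e i) t <= b 0 i] end.
have boxE : box a b = \bigcap_l H l.
  apply/seteqP; split=> [t tab l _|t tH i].
    rewrite /H; case: fintype.split => i /=; rewrite ?dote ?dotNe ?lerN2;
      by have /andP[] := tab i.
  have := tH (unsplit (inl i)) I; have := tH (unsplit (inr i)) I.
  by rewrite /H !unsplitK /= dote dotNe lerN2 => -> ->.
have Hclosed l : closed (H l).
  by rewrite /H; case: fintype.split => i; exact: half_space_closed.
have bc : closed (box a b) by rewrite boxE; exact: closed_bigI.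
exists (k + k)%N, H; split; [|split=> //; split; last by right].
  move=> l; rewrite /H; case: fintype.split => i.
    by exists (- e i), (- a 0 i); rewrite oppr_eq0; split=> //; left.
  by exists (e i), (b 0 i); split=> //; left.
rewrite closure_id in bc; rewrite -bc.
rewrite (_ : box a b =
  [set t | forall i, [set` `[a 0 i, b 0 i]] (t ord0 i)]).
  apply: (@rV_compact R k (fun i => [set` `[a 0 i, b 0 i]])) => i.
  exact: segment_compact.
apply/seteqP; split=> t /= h i; have := h i; by rewrite /= in_itv.
Qed.

Lemma basis_frame_free (I : multi_index n k) :
  row_free (basis_frame I : 'M[R]_(k, n)).
Proof.
apply/row_freeP; exists (basis_frame I)^T; apply/matrixP => i j; rewrite !mxE.
rewrite (bigD1 (val I i))//= !mxE eqxx mul1r.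
rewrite (inj_eq (@multi_index_inj _ _ I)) eq_sym big1 ?addr0// => l li.
by rewrite !mxE eq_sym (negbTE li) mul0r.
Qed.

End Cells.

Section Cube.
Context {R : realType} {n k : nat}.

Definition cube (p : 'rV[R]_n) (F : 'M[R]_(k, n)) (free : row_free F) (h : R)
    : oriented_cell R n k :=
  OrientedCell p free (box_affine_cell 0 (const_mx h)).

(** C is the Lipschitz constant of the chart with values in Dirac chains; that
    it does not depend on h is the point. *)
Lemma cube_chain p (F : 'M[R]_(k, n)) (free : row_free F) :
  exists2 C : R, 0 <= C & forall h, 0 < h -> exists2 J : Bchain R n k 1,
    represents_cell (cube p free h) J &
    `|(h ^+ k)^-1 *: J -
      embed (Bseminorm R n k 1) (Defs.dirac p (wedge F))| <= C * h.
Proof.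
set alpha := wedge F; pose g (t : 'rV[R]_k) := Defs.dirac (p + t *m F) alpha.
pose L := (\sum_j \sum_i `|F i j|) * mass alpha.
have L0 : 0 <= L.
  rewrite mulr_ge0 ?(sn_ge0 mass_seminorm)//.
  by do 2!apply: sumr_ge0 => ? _.
exists L => // h h0; have hk0 : 0 < h ^+ k by rewrite exprn_gt0.
have [J HJ] := cube_integral (ltW h0) L0 (frame_lipschitz p F alpha).
exists J; last first.
  (* The grid with one cell, tagged at the origin, has sum h ^+ k *: g 0. *)
  pose x (_ : 'I_k) (j : nat) : R := h * j%:R.
  pose t (_ : {ffun 'I_k -> 'I_1}) : 'rV[R]_k := 0.
  have G : tagged_grid 0 (const_mx h) h x t.
    split=> [i|i [|//] _|I i].
    - by rewrite /x !mxE mulr0 mulr1.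
    - by rewrite /x mulr0 mulr1 subr0 lexx ltW.
    - by rewrite /x mxE ord1 mulr0 mulr1 lexx ltW.
  have sumE : riemann_sum g x t = h ^+ k *: Defs.dirac p alpha.
    pose I0 : {ffun 'I_k -> 'I_1} := [ffun=> ord0].
    have I0E (I : {ffun 'I_k -> 'I_1}) : I = I0.
      by apply/ffunP => i; rewrite ffunE ord1.
    rewrite /riemann_sum (eq_bigl (pred1 I0)) => [|I]; last first.
      by rewrite /= (I0E I) eqxx.
    rewrite big_pred1_eq.
    rewrite /g /t mul0mx addr0; congr (_ *: _).
    under eq_bigr do rewrite ffunE /x mulr0 mulr1 subr0.
    by rewrite prodr_const card_ord.
  have {G} := HJ _ _ _ _ G; rewrite -/g sumE linearZ /= => hJ.
  rewrite -(scalerK (lt0r_neq0 hk0) (embed _ (Defs.dirac p alpha))) -scalerBr.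
  rewrite normrZ ger0_norm ?invr_ge0 ?(ltW hk0)//.
  by rewrite ler_pdivrMl.
move=> omega oB; have [C HC] := form_bounded oB.
exists 0, (const_mx h); split; first by move=> i; rewrite !mxE ltW.
split=> // e e0.
pose K := `|C| * (h ^+ k * L).
have K0 : 0 <= K by rewrite mulr_ge0// mulr_ge0// ltW.
have K1 : 0 < K + 1 by rewrite ltr_wpDl.
exists (e / (K + 1)); first exact: divr_gt0.
move=> m x t xab xd xt.
have G : tagged_grid 0 (const_mx h) (e / (K + 1)) x t.
  by split=> // i j jm; have /andP[-> /ltW ->] := xd i j jm.
rewrite distrC (_ : (\sum_J _) = omega (riemann_sum g x t)); last first.
  rewrite linear_sum; apply: eq_bigr => I _ /=.
  rewrite linearZ patchE mem_set /= 1?mulrC//.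
  exact: tagged_grid_tag G.
apply: le_lt_trans (chain_integral_dist _ _ oB HC) _.
apply: (@le_lt_trans _ _ (K * (e / (K + 1)))).
  have -> D : K * D = `|C| * (h ^+ k * (L * D)) by rewrite /K !mulrA.
  apply: le_trans (ler_wpM2r (normr_ge0 _) (ler_norm C)) _.
  by apply: ler_wpM2l => //; exact: HJ G.
by rewrite mulrA ltr_pdivrMr// mulrC ltr_pM2l// ltrDl.
Qed.

End Cube.

(** * Polyhedral chains approximate Dirac chains *)

Section Density.
Context {R : realType} {n k : nat}.

Lemma polyhedral_chainD (P Q : Bchain R n k 1) :
  polyhedral_chain P -> polyhedral_chain Q -> polyhedral_chain (P + Q).
Proof.
move=> [m [a [S [J [JS ->]]]]] [m' [a' [S' [J' [JS' ->]]]]].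
pose glue T (f : 'I_m -> T) (f' : 'I_m' -> T) (i : 'I_(m + m')) :=
  match fintype.split i with inl j => f j | inr j => f' j end.
exists (m + m')%N, (glue _ a a'), (glue _ S S'), (glue _ J J'); split.
  by move=> i; rewrite /glue; case: fintype.split.
rewrite big_split_ord /=; congr (_ + _); apply: eq_bigr => i _.
  by rewrite /glue (unsplitK (inl i)).
by rewrite /glue (unsplitK (inr i)).
Qed.

Lemma polyhedral_chainZ (c : R) (P : Bchain R n k 1) :
  polyhedral_chain P -> polyhedral_chain (c *: P).
Proof.
move=> [m [a [S [J [JS ->]]]]].
exists m, (fun i => c * a i), S, J; split=> //.
by rewrite scaler_sumr; apply: eq_bigr => i _; rewrite scalerA.
Qed.

Lemma polyhedral_chain_cell (Q : oriented_cell R n k) (J : Bchain R n k 1) :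
  represents_cell Q J -> polyhedral_chain J.
Proof.
move=> QJ; exists 1%N, (fun=> 1), (fun=> Q), (fun=> J).
by rewrite big_ord1 scale1r.
Qed.

Definition polyhedral_limit (x : Bchain R n k 1) :=
  forall e : R, 0 < e -> exists2 P, polyhedral_chain P & `|P - x| < e.

Lemma polyhedral_limit0 : polyhedral_limit 0.
Proof.
move=> e e0; exists 0; last by rewrite subrr normr0.
have absurd (i : 'I_0) : False by case: i.
exists 0%N, (fun=> 0), (fun i => False_rect _ (absurd i)), (fun=> 0).
by split=> [i|]; [case: (absurd i)|rewrite big_ord0].
Qed.

Lemma polyhedral_limitD x y :
  polyhedral_limit x -> polyhedral_limit y -> polyhedral_limit (x + y).
Proof.
move=> hx hy e e0; have e2 : 0 < e / 2 by rewrite divr_gt0.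
have [P PP Px] := hx _ e2; have [Q PQ Qy] := hy _ e2.
exists (P + Q); first exact: polyhedral_chainD.
rewrite opprD addrACA [e]splitr.
by apply: le_lt_trans (ler_normD _ _) _; exact: ltrD.
Qed.

Lemma polyhedral_limitZ c x : polyhedral_limit x -> polyhedral_limit (c *: x).
Proof.
move=> hx e e0; have c0 : 0 < `|c| + 1 by rewrite ltr_wpDl.
have [P PP Px] := hx _ (divr_gt0 e0 c0).
exists (c *: P); first exact: polyhedral_chainZ.
rewrite -scalerBr normrZ; move: Px; rewrite ltr_pdivlMr// => /(le_lt_trans _).
by apply; rewrite mulrC ler_wpM2l// lerDl.
Qed.

HB.instance Definition _ p := GRing.isLinear.Build R (kvector R n k)
  (dirac_chain R n k) *:%R (Defs.dirac p) (@dirac_linear R n k p).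

(** By linearity in alpha it is enough to treat alpha = wedge of a basis frame,
    which is the frame of a cube.  General simple k-vectors are avoided: their
    frame may fail to be free. *)
Lemma polyhedral_limit_dirac p (alpha : kvector R n k) :
  polyhedral_limit (embed (Bseminorm R n k 1) (Defs.dirac p alpha)).
Proof.
have -> : Defs.dirac p alpha =
    \sum_I alpha I *: Defs.dirac p (wedge (basis_frame I)).
  rewrite {1}(kvector_basis alpha) linear_sum.
  by apply: eq_bigr => I _; rewrite linearZ.
rewrite linear_sum; elim/big_rec: _ => [|I x _ hx].
  exact: polyhedral_limit0.
apply: polyhedral_limitD hx; rewrite linearZ; apply: polyhedral_limitZ => e e0.
have [C C0 HC] := cube_chain p (basis_frame_free I).
have C1 : 0 < C + 1 by rewrite ltr_wpDl.
have h0 := divr_gt0 e0 C1.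
have [J QJ Jd] := HC _ h0.
exists (((e / (C + 1)) ^+ k)^-1 *: J).
  exact/polyhedral_chainZ/polyhedral_chain_cell/QJ.
apply: le_lt_trans Jd _.
by rewrite mulrA ltr_pdivrMr// mulrC ltr_pM2l// ltrDl.
Qed.

Lemma polyhedral_limit_embed (A : dirac_chain R n k) :
  polyhedral_limit (embed (Bseminorm R n k 1) A).
Proof.
rewrite (dirac_chain_sum A) linear_sum.
elim/big_ind: _ => [|x y|p _]; first exact: polyhedral_limit0.
  exact: polyhedral_limitD.
exact: polyhedral_limit_dirac.
Qed.

End Density.

Theorem corollary2p11p6 (R : realType) (n k r : nat) (hr : (1 <= r)%N) :
  dense [set Bchain_incl r P | P in @polyhedral_chain R n k].
Proof.
move=> O O0 oO.
have [y [OA [A _ Ay]]] := embed_dense O0 oO; rewrite -{}Ay in OA.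
have /nbhs_ballP[e /= e0 eO] := open_nbhs_nbhs (conj oO OA).
have [P PP PA] := polyhedral_limit_embed A e0.
exists (Bchain_incl r P); split; last by exists P.
apply: eO; rewrite -ball_normE /= distrC.
exact: le_lt_trans (Bchain_incl_dist _ _ hr) PA.
Qed.
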